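(* Assume that $(c_i)_{i\ge1}$ is nonnegative and nondecreasing and that $\sum_{i=1}^\infty c_iq^i<\infty$. Then for every $i\ge1$ the discounted marginal productivity index is $$m_{(1,i)}=\begin{cases}\displaystyle\mu\Big[\frac{\beta(1-\beta^i)(1-\beta q)}{1-\beta}\sum_{j=1}^\infty(\beta q)^{j-1}c_{i+j}-\sum_{j=1}^i\beta^jc_j\Big]&\text{if }q>0,\\[2mm]\displaystyle\frac{\beta(1-\beta^i)}{1-\beta}\,c_{i+1}-\sum_{j=1}^i\beta^jc_j&\text{if }q=0.\end{cases}$$
   Context: Single-user model. Fix $\lambda\in(0,1]$ (packet arrival probability), $\mu\in(0,1]$ (transmission success probability), $\beta\in(0,1)$; put $p=\lambda\mu$, $q=1-p$. A controlled Markov chain $Y(t)=(B(t),X(t))$, $t=0,1,\dots$, lives on $\{0,1\}\times\{1,2,\dots\}$; $X(t)$ is the Age of Information, $B(t)=1$ iff a packet is available. Actions are $A(t)\in\{0,1\}$ ($1$ = attempt transmission). In states $(0,i)$ only action $0$ is available; in states $(1,i)$ both are. If $Y(t)=(b,i)$ and $A(t)=0$, then $X(t+1)=i+1$; if $Y(t)=(1,i)$ and $A(t)=1$, then $X(t+1)=1$ with probability $\mu$ and $i+1$ with probability $1-\mu$. In all cases $B(t+1)=1$ with probability $\lambda$ and $0$ otherwise, independently of $X(t+1)$. The cost in a slot with age $i$ is $c_i$. For a policy $\pi$ and initial state $(b,i)$: $F_{(b,i)}^\pi=\mathbb E_{(b,i)}^\pi[\sum_{t\ge0}c_{X(t)}\beta^t]$,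 $G_{(b,i)}^\pi=\mathbb E_{(b,i)}^\pi[\sum_{t\ge0}A(t)\beta^t]$. For an integer $k\ge0$ the $k$-policy takes action $1$ in state $(1,j)$ iff $j>k$; $\langle a,k\rangle$ is the policy taking action $a$ at $t=0$ and following the $k$-policy from $t=1$ onward. For $i\ge1$: $f_{(1,i)}^k=F_{(1,i)}^{\langle0,k\rangle}-F_{(1,i)}^{\langle1,k\rangle}$, $g_{(1,i)}^k=G_{(1,i)}^{\langle1,k\rangle}-G_{(1,i)}^{\langle0,k\rangle}$ (the latter is positive), and the marginal productivity index is $m_{(1,i)}=f_{(1,i)}^i/g_{(1,i)}^i$. *)

(* Defs.v *)
From HB Require Import structures.
From mathcomp Require Import all_boot all_order all_algebra.
From mathcomp Require Import all_classical all_reals all_analysis.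

Set Implicit Arguments.
Unset Strict Implicit.
Unset Printing Implicit Defensive.

Import Order.TTheory GRing.Theory Num.Theory.

Local Open Scope classical_set_scope.
Local Open Scope ring_scope.

(* A state (b, i): b says whether a packet is available, i is the age; the state
   space proper consists of the pairs with 0 < i, as imposed in aoi_model.  An
   action is a boolean, true being a transmission attempt. *)
Notation state := (bool * nat)%type.

(* Law of the next age, then of the next state, in state y under action a.
   The two coordinates of the next state are independent. *)
Definition age_law (R : realType) (mu : R) (y : state) (a : bool) (x : nat) : R :=
  if y.1 && a then mu * (x == 1%N)%:R + (1 - mu) * (x == y.2.+1)%:R
  else (x == y.2.+1)%:R.

Definition state_law (R : realType) (lambda mu : R) (y : state) (a : bool)
    (y' : state) : R :=
  (if y'.1 then lambda else 1 - lambda) * age_law mu y a y'.2.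

(* A policy may be randomized and history-dependent: pi h y is the probability
   of action 1 in state y when h lists the past state-action pairs, oldest
   first (so the current time is size h). *)
Definition policy (R : realType) := seq (state * bool) -> state -> R.

Definition admissible (R : realType) (pi : policy R) : Prop :=
  forall h y, 0 <= pi h y <= 1 /\ (y.1 = false -> pi h y = 0).

Definition kpolicy (R : realType) (k : nat) : policy R :=
  fun _ y => (y.1 && (k < y.2)%N)%:R.

(* Action a at time 0 (when available), the k-policy afterwards. *)
Definition akpolicy (R : realType) (a : bool) (k : nat) : policy R :=
  fun h y => if h is [::] then (y.1 && a)%:R else kpolicy R k h y.

Definition past (d : measure_display) (T : measurableType d)
    (Y : nat -> {mfun T >-> state}) (A : nat -> {mfun T >-> bool})
    (t : nat) (w : T) : seq (state * bool) :=
  mkseq (fun s => (Y s w, A s w)) t.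

(* Under P, the state process Y and action process A form the controlled chain
   started at y0 and governed by pi.  The last two clauses give the conditional
   laws of the action given the past and the current state, and of the next
   state given the past, the current state and the current action. *)
Definition controlled_chain (R : realType) (d : measure_display)
    (T : measurableType d) (lambda mu : R)
    (Y : nat -> {mfun T >-> state}) (A : nat -> {mfun T >-> bool})
    (P : probability T R) (pi : policy R) (y0 : state) : Prop :=
  [/\ P [set w | Y 0%N w = y0] = 1%E,
      forall t h y,
        P [set w | [/\ past Y A t w = h, Y t w = y & A t w = true]] =
        (P [set w | past Y A t w = h /\ Y t w = y] * (pi h y)%:E)%E
    & forall t h y a y',
        P [set w | [/\ past Y A t w = h, Y t w = y, A t w = a
                     & Y t.+1 w = y']] =
        (P [set w | [/\ past Y A t w = h, Y t w = y & A t w = a]] *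
         (state_law lambda mu y a y')%:E)%E].

(* P pi y0 is the law of the controlled process under pi from y0; the processes
   Y and A are common to all policies and initial states. *)
Definition aoi_model (R : realType) (d : measure_display)
    (T : measurableType d) (lambda mu : R)
    (Y : nat -> {mfun T >-> state}) (A : nat -> {mfun T >-> bool})
    (P : policy R -> state -> probability T R) : Prop :=
  (forall t w, (0 < (Y t w).2)%N) /\
  (forall (pi : policy R) (y0 : state), admissible pi -> (0 < y0.2)%N ->
     controlled_chain lambda mu Y A (P pi y0) pi y0).

Local Open Scope ereal_scope.

(* The performance measures are extended real: no finiteness is presupposed. *)
Definition cost_measure (R : realType) (d : measure_display)
    (T : measurableType d) (beta : R) (c : nat -> R)
    (Y : nat -> {mfun T >-> state})
    (P : policy R -> state -> probability T R)
    (pi : policy R) (y0 : state) : \bar R :=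
  \int[P pi y0]_w (\sum_(0 <= t <oo) (c (Y t w).2 * beta ^+ t)%:E).

Definition work_measure (R : realType) (d : measure_display)
    (T : measurableType d) (beta : R)
    (A : nat -> {mfun T >-> bool})
    (P : policy R -> state -> probability T R)
    (pi : policy R) (y0 : state) : \bar R :=
  \int[P pi y0]_w (\sum_(0 <= t <oo) ((A t w)%:R * beta ^+ t)%:E).

Definition marginal_cost (R : realType) (d : measure_display)
    (T : measurableType d) (beta : R) (c : nat -> R)
    (Y : nat -> {mfun T >-> state})
    (P : policy R -> state -> probability T R) (k i : nat) : \bar R :=
  cost_measure beta c Y P (akpolicy R false k) (true, i) -
  cost_measure beta c Y P (akpolicy R true k) (true, i).

Definition marginal_work (R : realType) (d : measure_display)
    (T : measurableType d) (beta : R)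
    (A : nat -> {mfun T >-> bool})
    (P : policy R -> state -> probability T R) (k i : nat) : \bar R :=
  work_measure beta A P (akpolicy R true k) (true, i) -
  work_measure beta A P (akpolicy R false k) (true, i).

(* The marginal productivity index of state (1, i). *)
Definition mp_index (R : realType) (d : measure_display)
    (T : measurableType d) (beta : R) (c : nat -> R)
    (Y : nat -> {mfun T >-> state}) (A : nat -> {mfun T >-> bool})
    (P : policy R -> state -> probability T R) (i : nat) : \bar R :=
  marginal_cost beta c Y P i i / marginal_work beta A P i i.

(* Main.v *)
(* Let W j be the discounted cost to go of the i-policy from age j, the packet
   indicator being averaged out (it is independent of the age).  Then
     W j = c_j + beta W (j+1)                   for j <= i,
     W j = c_j + beta (p W 1 + q W (j+1))       for j > i.
   Unrolling both recursions gives a 2 x 2 linear system for W 1 and W (i+1), of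
   determinant D = 1 - beta q - p beta^(i+1) > 0.  The work measure solves the
   same system for the reward lambda 1_{j > i}.  Hence the marginal cost is
     beta mu (W (i+1) - W 1)
       = beta mu ((1 - beta^i) (1 - beta q) S - (1 - beta) C) / D
   with S = sum_j (beta q)^(j-1) c_(i+j) and C = sum_(j <= i) beta^(j-1) c_j, the
   marginal work is (1 - beta) / D, and D cancels in the quotient. *)

Require Import Defs.
From HB Require Import structures.
From mathcomp Require Import all_boot all_order all_algebra.
From mathcomp Require Import all_classical all_reals all_analysis.
From mathcomp Require Import ring lra.
From mathcomp Require Import measurable_realfun.
Import numFieldNormedType.Exports.

Set Implicit Arguments.
Unset Strict Implicit.
Unset Printing Implicit Defensive.

Import Order.TTheory GRing.Theory Num.Theory.

Local Open Scope classical_set_scope.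
Local Open Scope ring_scope.

(** * Value iteration for a threshold policy *)

Section Discounted_values.
Variables (R : realType) (beta p : R) (k : nat).
Hypotheses (beta01 : 0 < beta < 1) (p01 : 0 <= p <= 1).

Let beta_ge0 : 0 <= beta. Proof. by case/andP: beta01 => /ltW. Qed.
Let p_ge0 : 0 <= p. Proof. by case/andP: p01. Qed.
Let q_ge0 : 0 <= 1 - p. Proof. by case/andP: p01; rewrite subr_ge0. Qed.
Let bq_ge0 : 0 <= beta * (1 - p). Proof. exact: mulr_ge0. Qed.
Let bq_lt1 : 0 < 1 - beta * (1 - p).
Proof. by case/andP: beta01 => b0 b1; case/andP: p01 => h0 h1; nra. Qed.

(** One-step expectation for the age alone under the [k]-policy. Here [p] is the probability that a
    packet is present and gets through. *)
Definition age_step (H : nat -> R) (j : nat) : R :=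
  if (k < j)%N then p * H 1%N + (1 - p) * H j.+1 else H j.+1.

Lemma age_step_ge0 H : (forall j, 0 <= H j) -> forall j, 0 <= age_step H j.
Proof.
move=> H0 j; rewrite /age_step; case: ifP => // _.
by apply: addr_ge0; apply: mulr_ge0.
Qed.

Lemma age_step_le H1 H2 : (forall j, H1 j <= H2 j) ->
  forall j, age_step H1 j <= age_step H2 j.
Proof.
move=> H12 j; rewrite /age_step; case: ifP => // _.
by apply: lerD; apply: ler_wpM2l.
Qed.

Lemma iter_age_step_ge0 H t : (forall j, 0 <= H j) ->
  forall j, 0 <= iter t age_step H j.
Proof. by move=> H0; elim: t => //= t; exact: age_step_ge0. Qed.

Variable c : nat -> R.
Hypothesis c0 : forall j, 0 <= c j.

Definition partial_value (n j : nat) : R :=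
  series (fun t => beta ^+ t * iter t age_step c j) n.

Lemma partial_value0 j : partial_value 0 j = 0.
Proof. by rewrite /partial_value /series /= big_nil. Qed.

Lemma partial_valueS n j :
  partial_value n.+1 j = c j + beta * age_step (partial_value n) j.
Proof.
rewrite /partial_value /series /= big_nat_recl //= expr0 mul1r; congr (_ + _).
rewrite /age_step; case: ifP => _; rewrite !(mulrDr, mulr_sumr) -?big_split /=;
  by apply: eq_bigr => t _; rewrite exprS; ring.
Qed.

Lemma partial_value_ge0 n j : 0 <= partial_value n j.
Proof.
apply: sumr_ge0 => t _; apply: mulr_ge0; last exact: iter_age_step_ge0.
exact: exprn_ge0.
Qed.

(** Value iteration is monotone and starts from 0, so it never passes a nonnegative fixed point. *)
Lemma partial_value_le V : (forall j, 0 <= V j) ->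
  (forall j, V j = c j + beta * age_step V j) ->
  forall n j, partial_value n j <= V j.
Proof.
move=> V0 VE; elim=> [|n IHn] j; first by rewrite partial_value0.
rewrite partial_valueS VE lerD2l ler_pM2l; last by case/andP: beta01.
exact: age_step_le.
Qed.

(** [S] stands for the discounted tail sum of [c] above the threshold. It is kept abstract to serve
    both the cost, where it is a series, and the work, where it is a constant. *)
Variable S : nat -> R.
Hypothesis S0 : forall j, (k < j)%N -> 0 <= S j.
Hypothesis SE :
  forall j, (k < j)%N -> S j = c j + beta * (1 - p) * S j.+1.
Hypothesis Scvg :
  series (fun m => (beta * (1 - p)) ^+ m * c (k.+1 + m)%N) @ \oo --> S k.+1.

(** Together with the next three definitions, this solves the system W(1) = C + beta^k W(k+1), (1 -
    beta q) W(k+1) = (1 - beta q) S(k+1) + beta p W(1), where q = 1 - p and C is [rise_cost]. *)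
Definition value_den : R := 1 - beta * (1 - p) - p * beta ^+ k.+1.
Definition rise_cost : R := \sum_(1 <= l < k.+1) beta ^+ (l - 1) * c l.
Definition value_above : R :=
  ((1 - beta * (1 - p)) * S k.+1 + beta * p * rise_cost) / value_den.
Definition value_reset : R := rise_cost + beta ^+ k * value_above.

Let bX_le1 : beta ^+ k <= 1.
Proof. by apply: exprn_ile1 => //; case/andP: beta01 => _ /ltW. Qed.

(** Since beta^k <= 1, the determinant is at least 1 - beta q - beta p = 1 - beta. *)
Lemma value_den_gt0 : 0 < value_den.
Proof.
rewrite /value_den exprS.
case/andP: beta01 => b0 b1; case/andP: p01 => h0 h1.
have h : beta * beta ^+ k <= beta by rewrite ger_pMr.
by nra.
Qed.

Lemma rise_cost_ge0 : 0 <= rise_cost.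
Proof.
by apply: sumr_ge0 => l _; rewrite mulr_ge0 // exprn_ge0.
Qed.

Lemma value_above_ge0 : 0 <= value_above.
Proof.
apply: divr_ge0; last exact/ltW/value_den_gt0.
apply: addr_ge0; first by rewrite mulr_ge0 ?S0 // ltW.
by rewrite !mulr_ge0 // rise_cost_ge0.
Qed.

Lemma value_reset_ge0 : 0 <= value_reset.
Proof.
rewrite addr_ge0 ?rise_cost_ge0 // mulr_ge0 ?value_above_ge0 //.
exact: exprn_ge0.
Qed.

Lemma value_aboveE :
  value_above = S k.+1 + beta * p / (1 - beta * (1 - p)) * value_reset.
Proof.
have d0 := value_den_gt0; rewrite /value_reset /value_above.
move: d0; rewrite /value_den exprS => d0.
field; apply/andP; split; first by rewrite lt0r_neq0.
by rewrite lt0r_neq0.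
Qed.

(* The candidate for the limit of the value iteration: minimality of the limit
   among nonnegative supersolutions bounds it above, so no growth condition on c
   is needed; unrolling the recursion above the threshold gives the converse
   bound at k + 1. *)
Definition threshold_value (j : nat) : R :=
  if (k < j)%N then S j + beta * p / (1 - beta * (1 - p)) * value_reset
  else \sum_(j <= l < k.+1) beta ^+ (l - j) * c l
       + beta ^+ (k.+1 - j) * value_above.

Lemma threshold_value_reset : threshold_value 1 = value_reset.
Proof.
rewrite /threshold_value; case: ifP => [|_]; last by rewrite subn1.
(* For k = 0 the age 1 already lies above the threshold, and [value_reset] collapses to
   [value_above]. *)
rewrite ltnS leqn0 => /eqP k0; rewrite -[in S 1%N]k0 -value_aboveE.
by rewrite /value_reset /rise_cost k0 big_geq // expr0 add0r mul1r.
Qed.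

Lemma threshold_value_ge0 j : 0 <= threshold_value j.
Proof.
rewrite /threshold_value; case: ifP => [kj|_]; apply: addr_ge0.
- exact: S0.
- by rewrite mulr_ge0 ?value_reset_ge0 // divr_ge0 ?mulr_ge0 // ltW.
- by apply: sumr_ge0 => l _; rewrite mulr_ge0 // exprn_ge0.
- by rewrite mulr_ge0 ?value_above_ge0 // exprn_ge0.
Qed.

Lemma threshold_value_fixpoint j :
  threshold_value j = c j + beta * age_step threshold_value j.
Proof.
rewrite /age_step threshold_value_reset; case: ifP => kj.
  rewrite /threshold_value kj (ltnW kj : (k < j.+1)%N) SE //.
  by field; rewrite lt0r_neq0.
rewrite /threshold_value kj; have jk : (j <= k)%N by rewrite leqNgt kj.
rewrite big_ltn // subnn expr0 mul1r -addrA; congr (_ + _).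
(* At j = k the next age crosses the threshold and falls under the other branch of
   [threshold_value]; [value_aboveE] glues the two. *)
move: jk; rewrite leq_eqVlt => /orP[/eqP ->|jk].
  by rewrite ltnSn big_geq // add0r subSnn expr1 -value_aboveE.
rewrite (ltnNge k) (jk : (j.+1 <= k)%N) /= mulrDr mulr_sumr; congr (_ + _).
  apply: eq_big_nat => l /andP[jl _]; rewrite mulrA -exprS; congr (_ ^+ _ * _).
  by rewrite -subSn.
by rewrite mulrA -exprS -subSn // ltnW.
Qed.

(** * Identification of the limit of value iteration *)

Let W j := limn (partial_value ^~ j).

Let cvg_W j : partial_value ^~ j @ \oo --> W j.
Proof.
apply/cvg_ex; eexists; apply: nondecreasing_cvgn.
  apply/nondecreasing_seqP => n.
  rewrite /partial_value seriesSr lerDl mulr_ge0 ?iter_age_step_ge0 //.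
  exact: exprn_ge0.
by exists (threshold_value j) => _ [n _ <-]; apply: partial_value_le => //;
  [exact: threshold_value_ge0|exact: threshold_value_fixpoint].
Qed.

Let W_le j : W j <= threshold_value j.
Proof.
apply: limr_le; first by apply/cvg_ex; eexists; exact: cvg_W.
apply: nearW => n; apply: partial_value_le => //.
  exact: threshold_value_ge0.
exact: threshold_value_fixpoint.
Qed.

Let W_ge0 j : 0 <= W j.
Proof.
apply: limr_ge; first by apply/cvg_ex; eexists; exact: cvg_W.
by apply: nearW => n; exact: partial_value_ge0.
Qed.

Let W_fix j : W j = c j + beta * age_step W j.
Proof.
have h : partial_value n.+1 j @[n --> \oo] --> c j + beta * age_step W j.
  under eq_fun do rewrite partial_valueS.
  apply: cvgD; first exact: cvg_cst.
  apply: cvgMr; rewrite /age_step; case: ifP => _ //.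
  by apply: cvgD; apply: cvgMr.
by move: (cvg_W (j := j)); rewrite -cvg_shiftS => /cvg_unique; apply.
Qed.

(** The fixed-point equation is unrolled n times from age k+1. The remainder (beta q)^n W(k+1+n) is
    nonnegative, and dropping it avoids having to show that it tends to 0. *)
Let W_above_ge n : series (fun m => (beta * (1 - p)) ^+ m * c (k.+1 + m)%N) n
  + beta * p * W 1 * series (fun m => (beta * (1 - p)) ^+ m) n <= W k.+1.
Proof.
suff -> : W k.+1 =
    series (fun m => (beta * (1 - p)) ^+ m * c (k.+1 + m)%N) n
    + beta * p * W 1 * series (fun m => (beta * (1 - p)) ^+ m) n
    + (beta * (1 - p)) ^+ n * W (k.+1 + n)%N.
  by rewrite lerDl mulr_ge0 // exprn_ge0.
elim: n => [|n IHn].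
  by rewrite /series /= !big_nil expr0 addn0; ring.
rewrite {1}IHn !seriesSr {1}(W_fix (k.+1 + n)) /age_step ifT; last first.
  by rewrite addSn ltnS leq_addr.
by rewrite exprS addnS; ring.
Qed.

Let W_reset : W 1 = rise_cost + beta ^+ k * W k.+1.
Proof.
have h n : (n <= k)%N -> W 1 =
    \sum_(1 <= l < n.+1) beta ^+ (l - 1) * c l + beta ^+ n * W n.+1.
  elim: n => [_|n IHn nk]; first by rewrite big_geq // expr0; ring.
  rewrite (IHn (ltnW nk)) [in RHS]big_nat_recr // (W_fix n.+1).
  rewrite /age_step ifF; last first.
    by apply/negbTE; rewrite -leqNgt.
  by rewrite subn1 /= exprSr; ring.
exact: h.
Qed.

Let W_aboveE : W k.+1 = value_above.
Proof.
apply/eqP; rewrite eq_le; apply/andP; split.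
  by rewrite (le_trans (W_le _)) // /threshold_value ltnSn value_aboveE.
have geo : `|beta * (1 - p)| < 1 by rewrite ger0_norm // -subr_gt0.
have lim : S k.+1 + beta * p * W 1 * (1 - beta * (1 - p))^-1 <= W k.+1.
  have h : (fun n => series (fun m => (beta * (1 - p)) ^+ m * c (k.+1 + m)%N) n
      + beta * p * W 1 * series (fun m => (beta * (1 - p)) ^+ m) n) @ \oo -->
      S k.+1 + beta * p * W 1 * (1 - beta * (1 - p))^-1.
    apply: cvgD => //; apply: cvgMr.
    have := cvg_geometric_series (a := 1) geo; rewrite mul1r /geometric /=.
    by under eq_fun do rewrite mul1r.
  rewrite -(cvg_lim _ h) //; apply: limr_le.
    by apply/cvg_ex; eexists; exact: h.
  by apply: nearW => n; exact: W_above_ge.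
rewrite /value_above ler_pdivrMr ?value_den_gt0 //.
(* Substituting [W_reset] for W(1) collects the coefficient of W(k+1) into the determinant
   [value_den]. *)
move: lim; rewrite -(ler_pM2r bq_lt1) mulrDl mulfVK ?lt0r_neq0 // W_reset.
by rewrite /value_den exprS; lra.
Qed.

Lemma cvg_value_above : partial_value ^~ k.+1 @ \oo --> value_above.
Proof. by rewrite -W_aboveE. Qed.

Lemma cvg_value_reset : partial_value ^~ 1%N @ \oo --> value_reset.
Proof. by rewrite /value_reset -W_aboveE -W_reset. Qed.

End Discounted_values.

(** * Integrals of functions of countable-valued random elements *)

Section Countable_fibers.
Variables (R : realType) (d : measure_display) (T : measurableType d).
Variables (mu : {measure set T -> \bar R}) (S : countType) (Z : T -> S).
Hypothesis mZ : forall z, measurable [set w | Z w = z].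

(** No sigma-algebra is put on [S], so that [Z] may be a history of states and actions. By
    countability, measurable fibres are enough. *)
Lemma measurable_countable_preimage (B : set S) : measurable (Z @^-1` B).
Proof.
rewrite [X in measurable X](_ : _ = \bigcup_z ([set w | Z w = z] `&` [set w | B z])).
  apply: countable_bigcupT_measurable => // z; apply: measurableI => //.
  have [Bz|nBz] := pselect (B z).
    by rewrite (_ : [set _ | _] = setT) //; apply/seteqP; split.
  by rewrite (_ : [set _ | _] = set0) //; apply/seteqP; split.
apply/seteqP; split => [w Bw|w [z _ [/= -> //]]].
by exists (Z w).
Qed.

Lemma measurable_fun_countable d' (U : measurableType d') (f : S -> U) :
  measurable_fun setT (f \o Z).
Proof.
move=> _ B mB; rewrite setTI (_ : _ @^-1` B = Z @^-1` (f @^-1` B)) //.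
exact: measurable_countable_preimage.
Qed.

(** Indexing the fibres by [pickle] gives a measurable partition over the naturals; codes of no
    element give empty pieces. *)
Lemma eq_ge0_integral_fibers (f g : T -> \bar R) :
  measurable_fun [set: T] f -> measurable_fun [set: T] g ->
  (forall w, 0 <= f w)%E -> (forall w, 0 <= g w)%E ->
  (forall z, \int[mu]_(w in [set w | Z w = z]) f w =
             \int[mu]_(w in [set w | Z w = z]) g w)%E ->
  (\int[mu]_w f w = \int[mu]_w g w)%E.
Proof.
move=> mf mg f0 g0 fg.
pose F n := [set w | pickle (Z w) = n].
have mF n : measurable (F n).
  exact: (measurable_countable_preimage [set z | pickle z = n]).
have FT : setT = \bigcup_n F n.
  by apply/seteqP; split => // w _; exists (pickle (Z w)).
have tF : trivIset setT F by move=> m n _ _ [w [<- <-]].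
rewrite FT !ge0_integral_bigcup -?FT //; apply: eq_eseriesr => n _.
case E : (pickle_inv n : option S) => [z|].
  rewrite (_ : F n = [set w | Z w = z]) //; apply/seteqP; split => w /=.
    by rewrite /F /= => Zw; move: E; rewrite -Zw pickleK_inv => -[].
  by move=> Zw; rewrite /F /= Zw; have := @pickle_invK S n; rewrite E.
rewrite (_ : F n = set0) ?integral_set0 //; apply/seteqP; split => w //=.
by rewrite /F /= => Zw; move: E; rewrite -Zw pickleK_inv.
Qed.

(** With [Z] the past, this sums the clauses of [controlled_chain] over all histories and so removes
    the conditioning on the past. *)
Lemma measure_fibers_scale (E F : set T) (r : R) :
  measurable E -> measurable F -> 0 <= r ->
  (forall z, mu (E `&` [set w | Z w = z]) = mu (F `&` [set w | Z w = z]) * r%:E)%E ->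
  (mu E = mu F * r%:E)%E.
Proof.
move=> mE mF r0 EF; rewrite muleC.
have mI (A : set T) : measurable A -> measurable_fun setT (fun w => (\1_A w : R)%:E).
  by move=> mA; exact/measurable_EFinP/measurable_indic.
have I0 (A : set T) w : (0 <= (\1_A w : R)%:E)%E by rewrite lee_fin indicE.
rewrite -[E]setIT -integral_indic // -[F in RHS]setIT -integral_indic //.
rewrite -ge0_integralZl_EFin //; last exact: mI.
apply: eq_ge0_integral_fibers => //.
- exact: mI.
- by apply: measurable_funeM; exact: mI.
- by move=> w; apply: mule_ge0 => //; rewrite lee_fin.
move=> z; rewrite ge0_integralZl_EFin //; last first.
  by apply: measurable_funTS; exact: mI.
by rewrite !integral_indic // EF muleC.
Qed.

(** The integrand is compared, fibre by fibre, with a finite combination of indicators. It serves to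
    integrate over the next state, which has finitely many possible values. *)
Lemma ge0_integral_finite_range (D : set T) (s : seq S) (f : S -> R) :
  measurable D -> uniq s -> (forall z, 0 <= f z) ->
  (forall z, z \notin s -> mu (D `&` [set w | Z w = z]) = 0)%E ->
  (\int[mu]_(w in D) (f (Z w))%:E =
   \sum_(z <- s) (f z)%:E * mu (D `&` [set w | Z w = z]))%E.
Proof.
move=> mD us f0 Ds0.
have mDz z : measurable (D `&` [set w | Z w = z]) by exact: measurableI.
have mf : measurable_fun setT (fun w => (f (Z w))%:E).
  exact: (@measurable_fun_countable _ _ (fun z => (f z)%:E)).
have mI (A : set T) : measurable A -> measurable_fun setT (fun w => (\1_A w : R)%:E).
  by move=> mA; exact/measurable_EFinP/measurable_indic.
have I0 (A : set T) w : (0 <= (\1_A w : R)%:E)%E by rewrite lee_fin indicE.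
have mg z : measurable_fun setT
    (fun w => (f z)%:E * (\1_(D `&` [set w | Z w = z]) w : R)%:E)%E.
  by apply: measurable_funeM; exact: mI.
have g0 z w : (0 <= (f z)%:E * (\1_(D `&` [set w | Z w = z]) w : R)%:E)%E.
  by apply: mule_ge0 => //; rewrite lee_fin.
transitivity (\int[mu]_w
    \sum_(z <- s) (f z)%:E * (\1_(D `&` [set w | Z w = z]) w : R)%:E)%E; last first.
  rewrite ge0_integral_sum //; apply: eq_bigr => z _.
  rewrite ge0_integralZl_EFin //; last exact: mI.
  by rewrite integral_indic // setIT.
rewrite integral_mkcond; apply: eq_ge0_integral_fibers.
- by apply/(measurable_restrictT _ _).1 => //; exact: measurable_funTS.
- exact: emeasurable_sum.
- by apply: erestrict_ge0 => w _; rewrite lee_fin.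
- by move=> w; exact: sume_ge0.
(* On a fibre with value in [s] exactly one summand can survive. On any other fibre the sum is 0 and
   [D] meets the fibre in a null set. *)
move=> z0; have [z0s|z0s] := boolP (z0 \in s).
  apply: eq_integral => w; rewrite inE /= => Zw.
  rewrite (bigD1_seq z0) //= big1 ?adde0; last first.
    move=> z zz0; rewrite indicE memNset ?mule0 // => -[_ /= Zw'].
    by move: zz0; rewrite -Zw -Zw' eqxx.
  rewrite /patch indicE; case: ifPn => [wD|wD].
    by rewrite mem_set ?mule1 ?Zw //; split => //; exact: set_mem.
  by rewrite memNset ?mule0 // => -[/mem_set]; rewrite (negbTE wD).
rewrite [RHS](eq_integral (cst 0%E)); last first.
  move=> w; rewrite inE /= => Zw; apply: big1_seq => z /= zs.
  rewrite indicE memNset ?mule0 // => -[_ /= Zw'].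
  by move: z0s; rewrite -Zw Zw' zs.
rewrite integral0 (eq_integral (fun w => (f z0)%:E * (\1_D w : R)%:E)%E).
  rewrite ge0_integralZl_EFin //; last by apply: measurable_funTS; exact: mI.
  by rewrite integral_indic // Ds0 // mule0.
move=> w; rewrite inE /= => <-; rewrite /patch indicE.
by case: ifPn; rewrite ?mule1 ?mule0.
Qed.

End Countable_fibers.

(** * The controlled chain under a deterministic Markov policy *)

Section Markov_chain.
Variables (R : realType) (d : measure_display) (T : measurableType d).
Variables (lambda mu : R).
Variables (Y : nat -> {mfun T >-> state}) (A : nat -> {mfun T >-> bool}).
Variables (P : probability T R) (pi : policy R) (y0 : state).
(** The decision depends on time in order to cover [akpolicy], whose action at time 0 is prescribed
    separately. *)
Variable act : nat -> state -> bool.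
Hypotheses (lambda01 : 0 <= lambda <= 1) (mu01 : 0 <= mu <= 1).
Hypothesis age_gt0 : forall t w, (0 < (Y t w).2)%N.
Hypothesis piE : forall h y, pi h y = (act (size h) y)%:R.
Hypothesis chain : controlled_chain lambda mu Y A P pi y0.

Lemma measurable_state_fiber t y : measurable [set w | Y t w = y].
Proof.
rewrite (_ : [set _ | _] = Y t @^-1` [set y]) //.
apply: measurable_funPTI; rewrite (_ : [set y] = [set y.1] `*` [set y.2]).
  exact: measurableX.
by apply/seteqP; split => [_ ->//|[b i] /= [-> ->]]; case: y.
Qed.

Lemma measurable_action_fiber t a : measurable [set w | A t w = a].
Proof. exact: (measurable_funPTI (A t) (Y := [set a])). Qed.

Lemma size_past t w : size (past Y A t w) = t.
Proof. exact: size_mkseq. Qed.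

Lemma pastS t w : past Y A t.+1 w = rcons (past Y A t w) (Y t w, A t w).
Proof. exact: mkseqS. Qed.

Lemma measurable_past_fiber t h : measurable [set w | past Y A t w = h].
Proof.
elim: t h => [|t IHt] h.
  have [->|h0] := eqVneq h [::].
    by rewrite (_ : [set _ | _] = setT) //; apply/seteqP; split.
  rewrite (_ : [set _ | _] = set0) //; apply/seteqP; split => // w /=.
  by rewrite /past /= => h0'; rewrite -h0' in h0.
case/lastP: h => [|h [y a]].
  by rewrite (_ : [set _ | _] = set0) //; apply/seteqP; split.
rewrite (_ : [set _ | _] = [set w | past Y A t w = h] `&`
    ([set w | Y t w = y] `&` [set w | A t w = a])).
  apply: measurableI => //; apply: measurableI.
    exact: measurable_state_fiber.
  exact: measurable_action_fiber.
apply/seteqP; split => w.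
  move=> pw; have : past Y A t.+1 w = rcons h (y, a) := pw.
  by rewrite pastS => /rcons_inj[/= -> -> ->].
move=> [ph [py pa]]; change (past Y A t.+1 w = rcons h (y, a)).
by rewrite pastS ph py pa.
Qed.

Let measE t y := measurable_state_fiber t y.
Let measA t a := measurable_action_fiber t a.

Lemma action_attempt t y :
  P ([set w | Y t w = y] `&` [set w | A t w = true]) =
  (P [set w | Y t w = y] * (act t y)%:R%:E)%E.
Proof.
apply: (measure_fibers_scale (@measurable_past_fiber t)) => //.
  exact: measurableI.
case: chain => _ hA _ h.
have -> : [set w | Y t w = y] `&` [set w | A t w = true] `&`
    [set w | past Y A t w = h] =
    [set w | [/\ past Y A t w = h, Y t w = y & A t w = true]].
  by apply/seteqP; split => w /= => [[[]]|[]].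
apply: (etrans (hA t h y)); rewrite piE setIC.
(* A history of length other than t has an empty fibre at time t, so both sides vanish. *)
have [->//|ht] := eqVneq (size h) t.
rewrite (_ : [set _ | _ /\ _] = set0) ?setI0 ?measure0 ?mul0e //; last first.
  by apply/seteqP; split => // w /= [hw _]; rewrite -hw size_past eqxx in ht.
rewrite (_ : _ `&` _ = set0) ?measure0 ?mul0e //.
by apply/seteqP; split => // w /= [hw _]; rewrite -hw size_past eqxx in ht.
Qed.

(** The model specifies only the probability of an attempt; that of waiting follows by subtraction,
    all quantities being finite. *)
Lemma action_law t y a :
  P ([set w | Y t w = y] `&` [set w | A t w = a]) =
  (P [set w | Y t w = y] * (a == act t y)%:R%:E)%E.
Proof.
case: a; first by rewrite action_attempt; case: (act t y).
have PyE : (P [set w | Y t w = y] =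
    P ([set w | Y t w = y] `\` [set w | A t w = true]) +
    P ([set w | Y t w = y] `&` [set w | A t w = true]))%E.
  exact: measureDI.
have -> : [set w | Y t w = y] `&` [set w | A t w = false] =
    [set w | Y t w = y] `\` [set w | A t w = true].
  by apply/seteqP; split => w /= -[->]; case: (A t w).
have fy : P [set w | Y t w = y] \is a fin_num by exact: fin_num_measure.
have fd : P ([set w | Y t w = y] `\` [set w | A t w = true]) \is a fin_num.
  by apply: fin_num_measure; exact: measurableD.
move: PyE; rewrite action_attempt -(fineK fy) -(fineK fd) -!EFinM -EFinD.
by move=> -[yE]; congr (_%:E); move: yE; case: (act t y) => /=; lra.
Qed.

Lemma transition_law t y a y' :
  P ([set w | Y t w = y] `&` [set w | A t w = a] `&` [set w | Y t.+1 w = y']) =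
  (P ([set w | Y t w = y] `&` [set w | A t w = a]) *
   (state_law lambda mu y a y')%:E)%E.
Proof.
have l0 : 0 <= state_law lambda mu y a y'.
  rewrite /state_law /age_law; case/andP: lambda01 => l0 l1.
  case/andP: mu01 => m0 m1.
  apply: mulr_ge0; first by case: ifP => _ //; rewrite subr_ge0.
  by case: ifP => _ //; apply: addr_ge0; apply: mulr_ge0 => //; rewrite subr_ge0.
apply: (measure_fibers_scale (@measurable_past_fiber t)) => //.
- by apply: measurableI => //; exact: measurableI.
- exact: measurableI.
case: chain => _ _ hY h.
have -> : [set w | Y t w = y] `&` [set w | A t w = a] `&`
    [set w | Y t.+1 w = y'] `&` [set w | past Y A t w = h] =
    [set w | [/\ past Y A t w = h, Y t w = y, A t w = a & Y t.+1 w = y']].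
  by apply/seteqP; split => w /= => [[[[]]]|[]].
apply: (etrans (hY t h y a y')); congr (P _ * _)%E.
by apply/seteqP; split => w /= => [[]|[[]]].
Qed.

(** The event is split according to whether the action agrees with [act]; by [action_law] the
    deviating part is null. *)
Lemma two_step_law t y y' :
  P ([set w | Y t w = y] `&` [set w | Y t.+1 w = y']) =
  (P [set w | Y t w = y] * (state_law lambda mu y (act t y) y')%:E)%E.
Proof.
have -> : (P ([set w | Y t w = y] `&` [set w | Y t.+1 w = y']) =
    P ([set w | Y t w = y] `&` [set w | Y t.+1 w = y'] `\`
       [set w | A t w = act t y]) +
    P ([set w | Y t w = y] `&` [set w | Y t.+1 w = y'] `&`
       [set w | A t w = act t y]))%E.
  by apply: measureDI => //; exact: measurableI.
rewrite [X in (P X + _)%E](_ : _ = [set w | Y t w = y] `&`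
  [set w | A t w = ~~ act t y] `&` [set w | Y t.+1 w = y']); last first.
  apply/seteqP; split => w /=.
    by move=> [[-> ->]]; case: (A t w); case: (act t y).
  by move=> [[-> ->] ->]; split => //; case: (act t y).
rewrite [X in (_ + P X)%E]setIAC !transition_law !action_law eqxx mule1.
by case: (act t y); rewrite mule0 mul0e add0e.
Qed.

Definition next_value (H : nat -> R) (y : state) (a : bool) : R :=
  if y.1 && a then mu * H 1%N + (1 - mu) * H y.2.+1 else H y.2.+1.

(** The next packet indicator is independent of the next age, so it can be integrated out first,
    leaving a function of the age for [next_value]. *)
Definition packet_average (psi : state -> R) (j : nat) : R :=
  lambda * psi (true, j) + (1 - lambda) * psi (false, j).

Lemma measurable_state_reward t (psi : state -> R) :
  measurable_fun setT (fun w => (psi (Y t w))%:E).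
Proof.
exact: (measurable_fun_countable (measE t) (fun z => (psi z)%:E)).
Qed.

Lemma packet_average_ge0 psi : (forall y, 0 <= psi y) ->
  forall j, 0 <= packet_average psi j.
Proof.
move=> psi0 j; case/andP: lambda01 => l0 l1.
by apply: addr_ge0; apply: mulr_ge0 => //; rewrite subr_ge0.
Qed.

Lemma next_value_ge0 H : (forall j, 0 <= H j) ->
  forall y a, 0 <= next_value H y a.
Proof.
move=> H0 y a; case/andP: mu01 => m0 m1; rewrite /next_value; case: ifP => _ //.
by apply: addr_ge0; apply: mulr_ge0 => //; rewrite subr_ge0.
Qed.

Lemma expectation_step t (psi : state -> R) : (forall y, 0 <= psi y) ->
  (\int[P]_w (psi (Y t.+1 w))%:E =
   \int[P]_w (next_value (packet_average psi) (Y t w) (act t (Y t w)))%:E)%E.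
Proof.
move=> psi0; have avg0 := packet_average_ge0 psi0.
apply: (eq_ge0_integral_fibers (measE t)).
- exact: measurable_state_reward.
- exact: (@measurable_state_reward t
    (fun y => next_value (packet_average psi) y (act t y))).
- by move=> w; rewrite lee_fin.
- by move=> w; rewrite lee_fin next_value_ge0.
move=> y; rewrite [RHS](eq_integral
    (cst (next_value (packet_average psi) y (act t y))%:E)); last first.
  by move=> w; rewrite inE /= => ->.
have -> v : (\int[P]_(w in [set w | Y t w = y]) cst v w =
    v * P [set w | Y t w = y])%E by rewrite integral_cst //; exact: measE.
have [y20|y20] := posnP y.2.
  rewrite (_ : [set _ | _] = set0) ?integral_set0 ?measure0 ?mule0 //.
  by apply/seteqP; split => // w /= yE; have := age_gt0 t w; rewrite yE y20.
(* The possible next states. Positivity of the current age makes the four entries distinct. *)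
pose s : seq state := [:: (true, 1%N); (false, 1%N); (true, y.2.+1); (false, y.2.+1)].
have -> : (\int[P]_(w in [set w | Y t w = y]) (psi (Y t.+1 w))%:E =
    \sum_(z <- s) (psi z)%:E *
      P ([set w | Y t w = y] `&` [set w | Y t.+1 w = z]))%E.
  apply: (ge0_integral_finite_range (measE t.+1)) => //.
    by rewrite /s /= !inE !xpair_eqE /=; case: (y.2) y20.
  move=> z zs; apply: (etrans (two_step_law _ _ _)).
  move: zs; rewrite /state_law /age_law /s !inE.
  case: z => -[] j; rewrite !xpair_eqE /= ?orbF negb_or;
    by move=> /andP[/negbTE -> /negbTE ->]; case: ifP => _;
      rewrite ?(mulr0, addr0) mule0.
rewrite !big_cons big_nil adde0 !two_step_law.
have fy : P [set w | Y t w = y] \is a fin_num by exact: fin_num_measure.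
rewrite -(fineK fy) -!EFinM -!EFinD; congr (_%:E).
rewrite /state_law /age_law /next_value /packet_average /=.
have -> : (1%N == y.2.+1) = false by case: (y.2) y20.
have -> : (y.2.+1 == 1%N) = false by case: (y.2) y20.
by rewrite !eqxx; case: ifP => _ /=; ring.
Qed.

Lemma expectation_start (psi : state -> R) : (forall y, 0 <= psi y) ->
  (\int[P]_w (psi (Y 0 w))%:E = (psi y0)%:E)%E.
Proof.
move=> psi0; case: chain => P0 _ _.
have P0z z : z != y0 -> P [set w | Y 0 w = z] = 0%E.
  move=> zy0; apply/eqP; rewrite eq_le measure_ge0 andbT.
  have : (P ([set w | Y 0 w = z] `|` [set w | Y 0 w = y0]) <= 1)%E.
    by apply: probability_le1; exact: measurableU.
  have -> : (P ([set w | Y 0 w = z] `|` [set w | Y 0 w = y0]) =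
      P [set w | Y 0 w = z] + P [set w | Y 0 w = y0])%E.
    apply: measureU => //; apply/seteqP; split => // w /= [-> yz].
    by move: zy0; rewrite yz eqxx.
  by rewrite P0 -[leRHS]add0e leeD2rE.
have -> : (\int[P]_w (psi (Y 0 w))%:E =
    \sum_(z <- [:: y0]) (psi z)%:E * P (setT `&` [set w | Y 0 w = z]))%E.
  apply: (ge0_integral_finite_range (measE 0)) => //.
  by move=> z; rewrite inE setTI => /P0z.
by rewrite big_seq1 setTI P0 mule1.
Qed.

(** Time 0 is split off because its action is prescribed. The rest is [next_value] of a value
    iteration, by linearity, and its limit is consulted only at the two ages reachable at time 1. *)
Lemma discounted_stream (beta : R) (p : R) (k : nat) (c W : nat -> R) (x : R)
    (y : state) (a : bool) (r : nat -> \bar R) :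
  partial_value beta p k c ^~ 1%N @ \oo --> W 1%N ->
  partial_value beta p k c ^~ y.2.+1 @ \oo --> W y.2.+1 ->
  r 0%N = x%:E ->
  (forall t, r t.+1 = (next_value (iter t (age_step p k) c) y a)%:E) ->
  (\sum_(0 <= t <oo) (beta ^+ t)%:E * r t = (x + beta * next_value W y a)%:E)%E.
Proof.
move=> W1 Wy r0 rS; apply: cvg_lim => //.
rewrite -cvg_shiftS.
have -> : (fun n => \sum_(0 <= t < n.+1) (beta ^+ t)%:E * r t)%E =
    EFin \o (fun n => x + beta * next_value (partial_value beta p k c n) y a).
  apply/funext => n /=; rewrite big_nat_recl //= expr0 mul1e r0 EFinD.
  congr (_ + _)%E; under eq_bigr do rewrite rS -EFinM; rewrite sumEFin.
  congr (_%:E); rewrite /next_value /partial_value /series /=.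
  case: ifP => _; rewrite !(mulrDr, mulr_sumr) -?big_split /=;
    by apply: eq_bigr => t _; rewrite exprS; ring.
apply: cvg_EFin; first by near=> n.
apply: cvgD; first exact: cvg_cst.
apply: cvgMr; rewrite /next_value; case: ifP => _ //.
by apply: cvgD; apply: cvgMr.
Unshelve. all: by end_near. Qed.

(** * Discounted cost and work when a threshold rule applies from time 1 on *)

Section Threshold.
Variable k : nat.
Hypothesis actS : forall t y, act t.+1 y = y.1 && (k < y.2)%N.

(** Above the threshold a reset requires both a packet and a success, which produces the product p =
    lambda mu and makes the age a Markov chain by itself. *)
Lemma packet_average_next H t j :
  packet_average (fun y => next_value H y (act t.+1 y)) j =
  age_step (lambda * mu) k H j.
Proof.
rewrite /packet_average /age_step /next_value !actS /=.
by case: ifP => _ /=; ring.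
Qed.

(** The induction peels off the last transition: [psi] is replaced by its one-step expectation,
    whose packet average is one more application of [age_step]. Hence [psi] must stay general. *)
Lemma expectation_later t (psi : state -> R) : (forall y, 0 <= psi y) ->
  (\int[P]_w (psi (Y t.+1 w))%:E =
   (next_value (iter t (age_step (lambda * mu) k) (packet_average psi)) y0
      (act 0 y0))%:E)%E.
Proof.
elim: t psi => [|t IHt] psi psi0; rewrite expectation_step //.
  rewrite (expectation_start (psi := fun y =>
    next_value (packet_average psi) y (act 0 y))) // => y.
  exact/next_value_ge0/packet_average_ge0.
rewrite (IHt (fun y => next_value (packet_average psi) y (act t.+1 y))).
  by rewrite iterSr; congr (next_value (iter _ _ _) _ _)%:E; apply/funext => j;
    rewrite packet_average_next.
by move=> y; exact/next_value_ge0/packet_average_ge0.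
Qed.

Lemma discounted_cost (beta : R) (c W : nat -> R) : 0 <= beta ->
  (forall j, 0 <= c j) ->
  partial_value beta (lambda * mu) k c ^~ 1%N @ \oo --> W 1%N ->
  partial_value beta (lambda * mu) k c ^~ y0.2.+1 @ \oo --> W y0.2.+1 ->
  (\int[P]_w \sum_(0 <= t <oo) (c (Y t w).2 * beta ^+ t)%:E =
   (c y0.2 + beta * next_value W y0 (act 0 y0))%:E)%E.
Proof.
move=> b0 c0 W1 Wy; rewrite integral_nneseries //; last 2 first.
- by move=> t; exact: (measurable_state_reward t (fun y => c y.2 * beta ^+ t)).
- by move=> t w _; rewrite lee_fin mulr_ge0 // exprn_ge0.
rewrite -(@discounted_stream _ _ _ _ _ _ _ _
  (fun t => \int[P]_w (c (Y t w).2)%:E)%E W1 Wy).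
- apply: eq_eseriesr => t _; rewrite -ge0_integralZl_EFin //.
  + by apply: eq_integral => w _; rewrite EFinM muleC.
  + by move=> w _; rewrite lee_fin.
  + exact: (measurable_state_reward t (fun y => c y.2)).
  + exact: exprn_ge0.
- exact: (expectation_start (psi := fun y => c y.2)).
- move=> t; rewrite (expectation_later t (psi := fun y => c y.2)) //.
  by congr (next_value (iter _ _ _) _ _)%:E; apply/funext => j;
    rewrite /packet_average /=; ring.
Qed.

Lemma expectation_action t :
  (\int[P]_w ((A t w)%:R)%:E = \int[P]_w ((act t (Y t w))%:R)%:E)%E.
Proof.
apply: (eq_ge0_integral_fibers (measE t)) => //.
- exact: (measurable_fun_countable (measA t) (fun a => (a%:R)%:E)).
- exact: (measurable_state_reward t (fun y => (act t y)%:R)).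
move=> y; rewrite [RHS](eq_integral (cst ((act t y)%:R)%:E)); last first.
  by move=> w; rewrite inE /= => ->.
have -> v : (\int[P]_(w in [set w | Y t w = y]) cst v w =
    v * P [set w | Y t w = y])%E by rewrite integral_cst //; exact: measE.
have -> : (\int[P]_(w in [set w | Y t w = y]) ((A t w)%:R)%:E =
    \sum_(a <- [:: true; false]) (a%:R)%:E *
      P ([set w | Y t w = y] `&` [set w | A t w = a]))%E.
  by apply: (ge0_integral_finite_range (measA t) (f := fun a => a%:R)) => //; case.
rewrite !big_cons big_nil action_law mul0e mul1e !adde0 muleC.
by case: (act t y).
Qed.

(** Work is treated as a cost stream: from time 1 on, averaging over the packet gives an attempt at
    age j with probability lambda if j > k and 0 otherwise. *)
Lemma discounted_work (beta : R) (W : nat -> R) : 0 <= beta ->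
  partial_value beta (lambda * mu) k (fun j => lambda * (k < j)%N%:R) ^~ 1%N
    @ \oo --> W 1%N ->
  partial_value beta (lambda * mu) k (fun j => lambda * (k < j)%N%:R) ^~ y0.2.+1
    @ \oo --> W y0.2.+1 ->
  (\int[P]_w \sum_(0 <= t <oo) ((A t w)%:R * beta ^+ t)%:E =
   ((act 0 y0)%:R + beta * next_value W y0 (act 0 y0))%:E)%E.
Proof.
move=> b0 W1 Wy; rewrite integral_nneseries //; last 2 first.
- move=> t.
  exact: (measurable_fun_countable (measA t) (fun a => (a%:R * beta ^+ t)%:E)).
- by move=> t w _; rewrite lee_fin mulr_ge0 // exprn_ge0.
rewrite -(@discounted_stream _ _ _ _ _ _ _ _
  (fun t => \int[P]_w ((A t w)%:R)%:E)%E W1 Wy).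
- apply: eq_eseriesr => t _; rewrite -ge0_integralZl_EFin //.
  + by apply: eq_integral => w _; rewrite EFinM muleC.
  + exact: (measurable_fun_countable (measA t) (fun a => (a%:R)%:E)).
  + exact: exprn_ge0.
- rewrite expectation_action.
  by rewrite (expectation_start (psi := fun y => (act 0 y)%:R)).
- move=> t; rewrite expectation_action.
  rewrite (expectation_later t (psi := fun y => (act t.+1 y)%:R)) //.
  by congr (next_value (iter _ _ _) _ _)%:E; apply/funext => j;
    rewrite /packet_average !actS /= mulr0 addr0.
Qed.

End Threshold.
End Markov_chain.

(** * The index *)

Section Tail_series.
Variables (R : realType) (b : R) (c : nat -> R).

Definition tail_sum (j : nat) : R :=
  limn (series (fun m => b ^+ m * c (j + m)%N)).

Lemma tail_sum_recl j :
  cvgn (series (fun m => b ^+ m * c (j.+1 + m)%N)) ->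
  tail_sum j = c j + b * tail_sum j.+1.
Proof.
move=> cvg1; apply: cvg_lim => //; rewrite -cvg_shiftS.
rewrite (_ : (fun n => _) = fun n =>
    c j + b * series (fun m => b ^+ m * c (j.+1 + m)%N) n); last first.
  apply/funext => n; rewrite /series /= big_nat_recl // expr0 mul1r addn0.
  congr (_ + _); rewrite mulr_sumr; apply: eq_bigr => m _.
  by rewrite exprS addSnnS mulrA.
by apply: cvgD; [exact: cvg_cst|apply: cvgMr].
Qed.

Lemma tail_sum_ge0 j : 0 <= b -> (forall i, 0 <= c i) ->
  cvgn (series (fun m => b ^+ m * c (j + m)%N)) -> 0 <= tail_sum j.
Proof.
move=> b0 c0 cvgj; apply: limr_ge => //; apply: nearW => n.
by apply: sumr_ge0 => m _; rewrite mulr_ge0 // exprn_ge0.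
Qed.

Lemma eseries_tail_sum j : 0 <= b -> (forall i, 0 <= c i) ->
  cvgn (series (fun m => b ^+ m * c (j.+1 + m)%N)) ->
  (\sum_(1 <= l <oo) (b ^+ (l - 1) * c (j + l)%N)%:E = (tail_sum j.+1)%:E)%E.
Proof.
move=> b0 c0 cvgj; rewrite -nneseries_addn; last first.
  by move=> l; rewrite lee_fin mulr_ge0 // exprn_ge0.
rewrite /tail_sum -EFin_lim //; congr (limn _); apply/funext => n /=.
rewrite /series /= sumEFin; congr (_%:E); apply: eq_bigr => m _.
by rewrite addn1 subn1 addnS addSn.
Qed.

End Tail_series.

(** As beta^m <= 1, the terms are at most q^m c(j+m), that is q^(-j) times the terms of the assumed
    series from index j on. *)
Lemma is_cvg_discounted_tail (R : realType) (beta q : R) (c : nat -> R) j :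
  0 < beta < 1 -> 0 <= q -> (forall i, 0 <= c i) ->
  (\sum_(0 <= i <oo) (c i * q ^+ i)%:E < +oo)%E ->
  cvgn (series (fun m => (beta * q) ^+ m * c (j + m)%N)).
Proof.
move=> /andP[b0 b1] q0 c0 cq.
move: q0; rewrite le_eqVlt => /orP[/eqP q0|q0].
  (* For q = 0 the comparison would divide by 0. The series is then [c j] followed by zeros, a
     geometric series of ratio 0. *)
  rewrite (_ : (fun m => _) = geometric (c j) 0).
    by apply: is_cvg_geometric_series; rewrite normr0.
  apply/funext => -[|m]; rewrite /= -q0 mulr0 ?expr0 ?addn0 ?mulr1 ?mul1r //.
  by rewrite exprS !mul0r mulr0.
have cq0 i : 0 <= c i * q ^+ i by rewrite mulr_ge0 // exprn_ge0 // ltW.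
apply: (@series_le_cvg _ _ (fun m => q ^- j * (c (m + j)%N * q ^+ (m + j)))).
- by move=> m; rewrite mulr_ge0 // exprn_ge0 // mulr_ge0 // ltW.
- by move=> m; rewrite mulr_ge0 // invr_ge0 exprn_ge0 // ltW.
- move=> m; rewrite [leRHS](_ : _ = q ^+ m * c (j + m)%N); last first.
    by rewrite exprD addnC; field; rewrite expf_neq0 // lt0r_neq0.
  rewrite ler_wpM2r // exprMn ger_pMl ?exprn_gt0 //.
  by rewrite exprn_ile1 // ltW.
apply: is_cvg_seriesZ; apply: nnseries_is_cvg => //.
apply: le_lt_trans cq.
rewrite (nneseries_addn j (f := fun i => (c i * q ^+ i)%:E)) //.
rewrite (nneseries_split 0 j (f := fun i => (c i * q ^+ i)%:E)); last first.
  by move=> m _; rewrite lee_fin.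
by rewrite add0n leeDr // sume_ge0 // => m _; rewrite lee_fin.
Qed.

Definition ak_act (a : bool) (k t : nat) (y : state) : bool :=
  y.1 && (if t is 0 then a else (k < y.2)%N).

Lemma akpolicyE (R : realType) (a : bool) (k : nat) h y :
  akpolicy R a k h y = (ak_act a k (size h) y)%:R.
Proof. by case: h. Qed.

Lemma akpolicy_admissible (R : realType) (a : bool) (k : nat) :
  admissible (akpolicy R a k).
Proof.
move=> h y; rewrite akpolicyE; split; first by rewrite ler0n lern1 leq_b1.
by rewrite /ak_act => ->.
Qed.

(** * Marginal work, marginal cost and their quotient *)

Section Index.
Variables (R : realType) (d : measure_display) (T : measurableType d).
Variables (lambda mu beta : R).
Hypotheses (lambda01 : 0 < lambda <= 1) (mu01 : 0 < mu <= 1).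
Hypothesis beta01 : 0 < beta < 1.
Variables (Y : nat -> {mfun T >-> state}) (A : nat -> {mfun T >-> bool}).
Variable P : policy R -> state -> probability T R.
Hypothesis model : aoi_model lambda mu Y A P.
Variable i : nat.
Hypothesis i_gt0 : (0 < i)%N.

Let p := lambda * mu.
Let q := 1 - p.

Let lambda_itv : 0 <= lambda <= 1.
Proof. by case/andP: lambda01 => /ltW -> ->. Qed.

Let mu_itv : 0 <= mu <= 1.
Proof. by case/andP: mu01 => /ltW -> ->. Qed.

Let p01 : 0 <= p <= 1.
Proof.
case/andP: lambda_itv => l0 l1; case/andP: mu_itv => m0 m1.
by rewrite mulr_ge0 //= mulr_ile1.
Qed.

Let beta_ge0 : 0 <= beta. Proof. by case/andP: beta01 => /ltW. Qed.

Let q_ge0 : 0 <= q.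
Proof. by case/andP: p01 => _; rewrite subr_ge0. Qed.

Let bq_ge0 : 0 <= beta * q. Proof. exact: mulr_ge0. Qed.

Let chain a := model.2 _ (true, i) (akpolicy_admissible R a i) i_gt0.

Let den := value_den beta p i.

(** The difference is 1 - beta mu (W(i+1) - W(1)) with W(i+1) = lambda / D and W(1) = beta^i lambda
    / D, so its numerator is D - beta p (1 - beta^i) = 1 - beta. *)
Lemma marginal_workE :
  marginal_work beta A P i i = ((1 - beta) / den)%:E.
Proof.
pose c j := lambda * (i < j)%N%:R.
have c0 j : 0 <= c j by rewrite mulr_ge0 ?ler0n //; case/andP: lambda_itv.
(* Above the threshold the averaged reward is constantly lambda, so every tail is the same geometric
   sum. *)
pose S := fun _ : nat => lambda / (1 - beta * q).
have bq1 : 0 < 1 - beta * q.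
  by case/andP: beta01 => b0 b1; case/andP: p01 => h0 h1; rewrite /q; nra.
have S0 j : (i < j)%N -> 0 <= S j.
  by move=> _; rewrite divr_ge0 //; [case/andP: lambda_itv|exact: ltW].
have SE j : (i < j)%N -> S j = c j + beta * q * S j.+1.
  by move=> ij; rewrite /S /c ij mulr1; field; rewrite lt0r_neq0.
have Scvg : series (fun m => (beta * q) ^+ m * c (i.+1 + m)%N) @ \oo --> S i.+1.
  rewrite (_ : (fun m => _) = geometric lambda (beta * q)); last first.
    by apply/funext => m; rewrite /c addSn ltnS leq_addr mulr1 mulrC.
  by apply: cvg_geometric_series; rewrite ger0_norm // -subr_gt0.
(* Only the ages 1 and i+1 are consulted, and i > 0 keeps them apart. *)
pose W j := if j == 1%N then value_reset beta p i c S else value_above beta p i c S.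
have W1 := cvg_value_reset beta01 p01 c0 S0 SE Scvg.
have Wi := cvg_value_above beta01 p01 c0 S0 SE Scvg.
have work a : work_measure beta A P (akpolicy R a i) (true, i) =
    (a%:R + beta * next_value mu W (true, i) a)%:E.
  rewrite /work_measure (discounted_work lambda_itv mu_itv model.1 (akpolicyE R a i)
    (chain a) (k := i) (fun _ _ => erefl) (W := W)) //.
  by rewrite /W eqSS gtn_eqF.
rewrite /marginal_work !work -EFinB; congr (_%:E).
rewrite /next_value /= /W /= eqSS gtn_eqF //=.
have rise0 : rise_cost beta i c = 0.
  rewrite /rise_cost big_nat big1 // => l /andP[_]; rewrite /c ltnS leqNgt.
  by move=> /negbTE ->; rewrite !mulr0.
have := value_den_gt0 i beta01 p01; rewrite /value_reset /value_above rise0 -/den => den0.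
rewrite /S /den /value_den /q /p exprS in den0 bq1 *.
by field; rewrite !lt0r_neq0.
Qed.

Variable c : nat -> R.
Hypothesis c0 : forall j, 0 <= c j.
Hypothesis csum : (\sum_(0 <= j <oo) (c j * q ^+ j)%:E < +oo)%E.

(** The immediate cost [c i] cancels, leaving beta mu (W(i+1) - W(1)). The coefficient of
    [rise_cost] simplifies by beta p (1 - beta^i) - D = -(1 - beta). *)
Lemma marginal_costE : marginal_cost beta c Y P i i =
  (beta * mu * ((1 - beta ^+ i) * (1 - beta * q) * tail_sum (beta * q) c i.+1
                - (1 - beta) * rise_cost beta i c) / den)%:E.
Proof.
pose S := tail_sum (beta * q) c.
have cvgS j := is_cvg_discounted_tail (j := j) beta01 q_ge0 c0 csum.
have S0 j : (i < j)%N -> 0 <= S j by move=> _; exact: tail_sum_ge0.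
have SE j : (i < j)%N -> S j = c j + beta * q * S j.+1.
  by move=> _; exact: tail_sum_recl.
have Scvg : series (fun m => (beta * q) ^+ m * c (i.+1 + m)%N) @ \oo --> S i.+1.
  exact: cvgS.
pose W j := if j == 1%N then value_reset beta p i c S else value_above beta p i c S.
have W1 := cvg_value_reset beta01 p01 c0 S0 SE Scvg.
have Wi := cvg_value_above beta01 p01 c0 S0 SE Scvg.
have cost a : cost_measure beta c Y P (akpolicy R a i) (true, i) =
    (c i + beta * next_value mu W (true, i) a)%:E.
  rewrite /cost_measure (discounted_cost lambda_itv mu_itv model.1 (akpolicyE R a i)
    (chain a) (k := i) (fun _ _ => erefl) (W := W)) //.
  by rewrite /W eqSS gtn_eqF.
rewrite /marginal_cost !cost -EFinB; congr (_%:E).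
rewrite /next_value /= /W /= eqSS gtn_eqF //=.
have := value_den_gt0 i beta01 p01; rewrite /value_reset /value_above -/den => den0.
rewrite -/S /den /value_den /q /p exprS in den0 *.
by field; rewrite !lt0r_neq0.
Qed.

Lemma mp_indexE : mp_index beta c Y A P i =
  (mu * (beta * (1 - beta ^+ i) * (1 - beta * q) / (1 - beta)
           * tail_sum (beta * q) c i.+1
         - \sum_(1 <= j < i.+1) beta ^+ j * c j))%:E.
Proof.
have den0 : 0 < den := value_den_gt0 i beta01 p01.
have b1 : 0 < 1 - beta by case/andP: beta01 => _; rewrite subr_gt0.
(* Inversion of extended reals splits cases at 0; the marginal work (1 - beta) / D is nonzero. *)
rewrite /mp_index marginal_costE marginal_workE inver ifF; last first.
  by apply/negbTE; rewrite mulf_neq0 ?invr_eq0 ?lt0r_neq0.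
rewrite -EFinM; congr (_%:E).
have -> : \sum_(1 <= j < i.+1) beta ^+ j * c j = beta * rise_cost beta i c.
  rewrite mulr_sumr; apply: eq_big_nat => j /andP[j0 _].
  by rewrite mulrA -exprS subn1 prednK.
by field; rewrite !lt0r_neq0.
Qed.

End Index.

Theorem lemma6 (R : realType) (d : measure_display) (T : measurableType d)
    (lambda mu beta p q : R)
    (hlambda : 0 < lambda <= 1) (hmu : 0 < mu <= 1) (hbeta : 0 < beta < 1)
    (hp : p = lambda * mu) (hq : q = 1 - p)
    (Y : nat -> {mfun T >-> state}) (A : nat -> {mfun T >-> bool})
    (P : policy R -> state -> probability T R)
    (hP : aoi_model lambda mu Y A P)
    (c : nat -> R)
    (hc0 : forall i : nat, (1 <= i)%N -> 0 <= c i)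
    (hcmono : forall i j : nat, (1 <= i)%N -> (i <= j)%N -> c i <= c j)
    (hcsum : (\sum_(1 <= i <oo) (c i * q ^+ i)%:E < +oo)%E)
    (i : nat) (hi : (1 <= i)%N) :
  (0 < q ->
     mp_index beta c Y A P i =
     (mu%:E *
      ((beta * (1 - beta ^+ i) * (1 - beta * q) / (1 - beta))%:E *
         \sum_(1 <= j <oo) ((beta * q) ^+ (j - 1) * c (i + j)%N)%:E
       - (\sum_(1 <= j < i.+1) beta ^+ j * c j)%:E))%E) /\
  (q = 0 ->
     mp_index beta c Y A P i =
     (beta * (1 - beta ^+ i) / (1 - beta) * c i.+1
      - \sum_(1 <= j < i.+1) beta ^+ j * c j)%:E).
Proof.
(* c 0 is unconstrained, and irrelevant since ages are positive. *)
pose c' j := if (0 < j)%N then c j else 0.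
have c'E j : (0 < j)%N -> c' j = c j by rewrite /c' => ->.
have c'0 j : 0 <= c' j by rewrite /c'; case: ifP => // /hc0.
have q0 : 0 <= q.
  case/andP: hlambda => l0 l1; case/andP: hmu => m0 m1.
  by rewrite hq hp subr_ge0 mulr_ile1 // ltW.
have csum : (\sum_(0 <= j <oo) (c' j * q ^+ j)%:E < +oo)%E.
  rewrite nneseries_recl //; last by move=> j _; rewrite lee_fin mulr_ge0 // exprn_ge0.
  rewrite /c' mul0r add0e; apply: le_lt_trans hcsum.
  rewrite le_eqVlt; apply/orP; left; apply/eqP.
  rewrite [LHS]eseries_cond [RHS]eseries_cond; apply: eq_eseriesr => j /= j0.
  by rewrite ifT.
have -> : mp_index beta c Y A P i = mp_index beta c' Y A P i.
  rewrite /mp_index /marginal_cost; congr ((_ - _) / _)%E;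
  by apply: eq_integral => w _; apply: eq_eseriesr => t _; rewrite c'E ?hP.1.
rewrite hp in hq; rewrite hq in csum q0 *.
rewrite (mp_indexE hlambda hmu hbeta hP hi c'0 csum).
have sumE : \sum_(1 <= j < i.+1) beta ^+ j * c' j =
    \sum_(1 <= j < i.+1) beta ^+ j * c j.
  by apply: eq_big_nat => j /andP[j0 _]; rewrite c'E.
rewrite sumE.
have bq0 : 0 <= beta * (1 - lambda * mu).
  by rewrite mulr_ge0 //; case/andP: hbeta => /ltW.
have cvgS := is_cvg_discounted_tail (j := i.+1) hbeta q0 c'0 csum.
split=> [_|q00].
  rewrite (eq_eseriesr (g := fun j =>
    ((beta * (1 - lambda * mu)) ^+ (j - 1) * c' (i + j)%N)%:E)); last first.
    by move=> j _; rewrite c'E // addn_gt0 hi.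
  by rewrite eseries_tail_sum // -EFinM -EFinB -EFinM.
(* If q = 0 then lambda mu = 1 with both factors at most 1, so the prefactor mu disappears. *)
have mu1 : mu = 1.
  case/andP: hlambda => l0 l1; case/andP: hmu => m0 m1.
  by apply/eqP; rewrite eq_le m1 /=; nra.
(* With beta q = 0 the tail sum reduces to its first term. *)
rewrite tail_sum_recl; last exact: is_cvg_discounted_tail.
by rewrite c'E // q00 mu1 !mulr0 mul0r subr0 addr0 mulr1 mul1r.
Qed.
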